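(* Let $A$ be a subset of an abelian group $\Gamma$ such that at least one of the following conditions fails to hold: (1) $\langle 2a\rangle\cap A\neq\emptyset$ for all $a\in A$; (2) if $a,b,c\in\Gamma$ and $\langle a,b,c\rangle\cap A\neq\emptyset$, then $(\langle a,b\rangle\cup\langle b,c\rangle\cup\langle a,c\rangle)\cap A\neq\emptyset$. Then for every positive integer $t$, there is a graph $G_{\Gamma,A,t}$ with a $\Gamma$-labelling $\gamma$ such that for the set $\mathcal{O}$ of cycles of $G_{\Gamma,A,t}$ with $\gamma$-values in $A$, there are no two vertex-disjoint cycles in $\mathcal{O}$ and there is no hitting set for $\mathcal{O}$ of size at most $t$.
   Context: All graphs are undirected and simple. For an abelian group $\Gamma$, a $\Gamma$-labelling of a graph $G$ is a function $\gamma\colon E(G)\to\Gamma$, and the $\gamma$-value of a subgraph $H$ of $G$ is $\gamma(H)=\sum_{e\in E(H)}\gamma(e)$. $\langle S\rangle$ denotes the subgroup generated by $S$. A hitting set for a set $\mathcal{O}$ of cycles is a set of vertices meeting every cycle in $\mathcal{O}$. *)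

(* Defs.v *)
From HB Require Import structures.
From mathcomp Require Import all_boot all_algebra.
From mathcomp Require Import boolp classical_sets.

Set Implicit Arguments.
Unset Strict Implicit.
Unset Printing Implicit Defensive.

Import GRing.Theory.
Local Open Scope classical_set_scope.
Local Open Scope ring_scope.

Definition gen_subgroup (Gamma : zmodType) (S : set Gamma) : set Gamma :=
  smallest (fun H : set Gamma => zmod_closed [in H]) S.

Definition doubling_condition (Gamma : zmodType) (A : set Gamma) : Prop :=
  forall a, A a -> gen_subgroup [set a *+ 2] `&` A !=set0.

Definition three_generator_condition (Gamma : zmodType) (A : set Gamma) : Prop :=
  forall a b c : Gamma,
    gen_subgroup [set a; b; c] `&` A !=set0 ->
    (gen_subgroup [set a; b] `|` gen_subgroup [set b; c]
       `|` gen_subgroup [set a; c]) `&` A !=set0.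

Record sgraph := SGraph {
  vertex :> finType;
  adj : rel vertex;
  adj_sym : symmetric adj;
  adj_irrefl : irreflexive adj
}.

Definition edge_set (G : sgraph) : {set {set G}} :=
  [set [set u.1; u.2]%SET | u : G * G & adj u.1 u.2]%SET.

Definition edge (G : sgraph) : finType := {e : {set G} | e \in edge_set G}.

Definition labelling (Gamma : zmodType) (G : sgraph) : Type := edge G -> Gamma.

Record subgraph (G : sgraph) := Subgraph {
  sub_verts : {set G};
  sub_edges : {set edge G};
  sub_incident : forall e, e \in sub_edges -> val e \subset sub_verts
}.

Definition value (Gamma : zmodType) (G : sgraph) (gamma : labelling Gamma G)
    (H : subgraph G) : Gamma :=
  \sum_(e in sub_edges H) gamma e.

(* [next p x] is the cyclic successor of [x] in [p], so the last vertex of [p]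
   is joined back to the first.  A cycle of a simple graph has length at
   least 3; MathComp's [cycle] alone also accepts shorter sequences. *)
Definition is_cycle (G : sgraph) (C : subgraph G) : Prop :=
  exists p : seq G,
    [/\ (2 < size p)%N, uniq p, cycle (@adj G) p,
        forall x : G, (x \in sub_verts C) = (x \in p)
      & forall e : edge G,
          (e \in sub_edges C) = (val e \in [seq [set x; next p x]%SET | x <- p])].

Definition cycles_with_value_in (Gamma : zmodType) (A : set Gamma) (G : sgraph)
    (gamma : labelling Gamma G) : set (subgraph G) :=
  [set C | is_cycle C /\ A (value gamma C)].

Definition vertex_disjoint (G : sgraph) (H1 H2 : subgraph G) : Prop :=
  [disjoint sub_verts H1 & sub_verts H2]%B.

Definition hitting_set (G : sgraph) (O : set (subgraph G)) (X : {set G}) : Prop :=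
  forall C, O C -> exists2 x, x \in X & x \in sub_verts C.

(* Main.v *)
(** Both graphs are grids whose top row (row 0) carries the labels, and both
   arguments rest on one parity fact: if the plane is cut along the top row and
   further edges are drawn above it, then two vertex-disjoint closed walks
   cross an even number of times, and all crossings are between the edges
   drawn above the top row.

   If [a] in [A] and [<2a>] misses [A], add to the grid pairwise crossing
   edges, labelled [a], between the left and the right half of the top row.  A
   cycle with value in [A] uses an odd number of them, so two disjoint ones
   would cross an odd number of times.

   If the three-generator condition fails, then after replacing [a], [b], [c]
   by multiples, [a + b + c] is in [A] while no two of them generate a subgroup
   meeting [A].  Label every other edge of the top row by [a] on its left
   third, by [b] on its middle third and by [c] on its right third.  A cycle
   with value in [A] touches all three thirds.  If two such cycles are disjoint
   and the first touches the middle third to the left of the second, then a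
   path of the first from the middle to the right third and a path of the
   second from the left to the middle third have interleaving ends, which the
   parity fact, applied after joining the ends of each path, excludes. *)

Require Import Defs.
From mathcomp Require Import all_boot all_algebra.
From mathcomp Require Import boolp classical_sets.
From mathcomp Require Import zify.

Set Implicit Arguments.
Unset Strict Implicit.
Unset Printing Implicit Defensive.

Import GRing.Theory.

(** * Walks as lists of steps *)

Section Walks.

Variable T : eqType.
Implicit Types (x y : T) (p q : seq T).

Definition steps x p : seq (T * T) := zip (x :: p) p.

Lemma steps_cat x p q : steps x (p ++ q) = steps x p ++ steps (last x p) q.
Proof. by elim: p x => [|y p IH] x //=; rewrite -IH. Qed.

Lemma steps_rcons x p y : steps x (rcons p y) = rcons (steps x p) (last x p, y).
Proof. by rewrite -!cats1 steps_cat. Qed.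

Lemma mem_steps (e : rel T) x p s : path e x p -> s \in steps x p ->
  [/\ e s.1 s.2, s.1 \in x :: p & s.2 \in x :: p].
Proof.
elim: p x => [|y p IH] x //= /andP[exy pyp].
rewrite inE => /orP[/eqP->|sP] /=; first by rewrite !inE !eqxx ?orbT.
by have [? s1 s2] := IH _ pyp sP; split=> //; apply/predU1P; right.
Qed.

Lemma sum_steps_telescope (f : T -> bool) x p :
  \big[addb/false]_(s <- steps x p) (f s.1 (+) f s.2) = f x (+) f (last x p).
Proof.
elim: p x => [|y p IH] x; first by rewrite big_nil addbb.
by rewrite /steps /= big_cons IH addbA addbK.
Qed.

(** The wrap-around vertex [x0] is kept apart from the first vertex so that the induction on [p]
    goes through. *)
Lemma map_next_at (x0 x : T) p : uniq (x :: p) ->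
  [seq (u, next_at u x0 x p) | u <- x :: p] = steps x (rcons p x0).
Proof.
elim: p x => [|y p IH] x; first by rewrite /= eqxx.
case/andP=> xNyp uyp; rewrite -[RHS]/((x, y) :: steps y (rcons p x0)) -IH //.
have /eq_in_map E : {in y :: p,
    (fun u => (u, next_at u x0 x (y :: p))) =1 (fun u => (u, next_at u x0 y p))}.
  by move=> u uyp' /=; case: (eqVneq x u) uyp' xNyp => // -> ->.
by rewrite map_cons E /= eqxx.
Qed.

Lemma map_next x p : uniq (x :: p) ->
  [seq (u, next (x :: p) u) | u <- x :: p] = steps x (rcons p x).
Proof. exact: map_next_at. Qed.

(** A cycle of length at least three never traverses an edge back at once; this makes its edges
    pairwise distinct. *)
Lemma next_next_neq p x : uniq p -> 2 < size p -> x \in p ->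
  next p (next p x) != x.
Proof.
move=> Up p_gt2 /rot_to[i q def_q].
rewrite -!(next_rot i Up) def_q.
have : uniq (x :: q) by rewrite -def_q rot_uniq.
have : 2 < size (x :: q) by rewrite -def_q size_rot.
case: q {def_q} => [|y [|z q]] //= _; rewrite !inE !negb_or eqxx.
case/and4P=> /and3P[xy xz _] _ _ _.
by rewrite [y == x]eq_sym (negPf xy) eqxx eq_sym.
Qed.

Lemma cycle_subpath (e : rel T) p x y : uniq p -> cycle e p ->
    x \in p -> y \in p ->
  exists q, [/\ path e x q, last x q = y & {subset x :: q <= p}].
Proof.
move=> Up ep /rot_to[i q def_q] yp.
have mem_q : x :: q =i p by move=> u; rewrite -def_q mem_rot.
have : cycle e (x :: q) by rewrite -def_q rot_cycle.
rewrite /= rcons_path => /andP[eq _].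
have yq : y \in x :: q by rewrite mem_q.
case/splitPl: yq eq mem_q => q1 q2 lastq1; rewrite cat_path => /andP[eq1 _] mem_q.
exists q1; split=> // u uq1; rewrite -mem_q in_cons mem_cat.
by move: uq1; rewrite in_cons => /orP[->|->] //; rewrite orbT.
Qed.

End Walks.

Lemma eq_set2 (T : finType) (a b c d : T) : [set a; b]%SET = [set c; d]%SET ->
  a = c /\ b = d \/ a = d /\ b = c.
Proof.
move/setP=> E; have:= (E a, E b, E c, E d); rewrite !inE !eqxx ?orbT /=.
case=> -[[/esym/orP[]/eqP-> /esym/orP[]/eqP->]]; rewrite ?orbb; auto.
- by move=> _ /eqP ->; auto.
- by move=> /eqP ->; auto.
Qed.

(** * Values of cycles as sums along closed walks *)

Section CycleValue.

Local Open Scope ring_scope.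

Variables (Gamma : zmodType) (G : sgraph) (lab : G -> G -> Gamma).
Hypothesis labC : forall u v, lab u v = lab v u.

(** An edge is an unordered pair, so [pick] chooses one of its orientations; by [labC] the choice
    does not affect the label. Every edge has two ends, so the default 0 is never taken. *)
Definition edge_labelling : labelling Gamma G := fun e =>
  if [pick u : G * G | val e == [set u.1; u.2]%SET] is Some u
  then lab u.1 u.2 else 0.

Lemma edge_labellingE (e : edge G) u v :
  val e = [set u; v]%SET -> edge_labelling e = lab u v.
Proof.
rewrite /edge_labelling => ->; case: pickP => [[c d] /= /eqP|/(_ (u, v))].
  by case/eq_set2=> -[-> ->].
by rewrite eqxx.
Qed.

Lemma adj_edge u v : adj u v -> [set u; v]%SET \in edge_set G.
Proof. by move=> uv; rewrite /edge_set; apply/imsetP; exists (u, v); rewrite ?inE. Qed.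

Lemma cycle_edges_uniq (p : seq G) : uniq p -> (2 < size p)%N ->
  uniq [seq [set u; next p u]%SET | u <- p].
Proof.
move=> Up p_gt2; rewrite map_inj_in_uniq // => u v up vp /eq_set2[[]//|[uv vu]].
by have := next_next_neq Up p_gt2 up; rewrite vu -uv eqxx.
Qed.

Lemma value_cycle (C : subgraph G) x p :
    uniq (x :: p) -> (2 < size (x :: p))%N -> cycle (@adj G) (x :: p) ->
    (forall e : edge G, (e \in sub_edges C) =
       (val e \in [seq [set u; next (x :: p) u]%SET | u <- x :: p])) ->
  value edge_labelling C = \sum_(s <- steps x (rcons p x)) lab s.1 s.2.
Proof.
move=> Up p_gt2 Ep edgesC.
set E := [seq [set u; next (x :: p) u]%SET | u <- x :: p] in edgesC.
have EE : {subset E <= edge_set G}.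
  move=> _ /mapP[u up ->]; apply: adj_edge; exact: next_cycle Ep up.
pose es : seq (edge G) := pmap insub E.
have val_es : map val es = E.
  rewrite /es pmap_filter; last exact: insubK.
  by apply/all_filterP/allP=> S /EE SE; rewrite insubT.
have U_es : uniq es by rewrite -(map_inj_uniq val_inj) val_es cycle_edges_uniq.
have mem_es e : (e \in sub_edges C) = (e \in es).
  by rewrite edgesC -val_es mem_map //; apply: val_inj.
rewrite /value (eq_bigl _ _ mem_es) -big_uniq //=.
(* Extending the labelling by 0 to all vertex sets lets the sum be reindexed along the list [E]. *)
pose g S := if insub S is Some e then edge_labelling e else 0.
transitivity (\sum_(e <- es) g (val e)).
  by apply: eq_bigr => e _; rewrite /g valK.
rewrite -(big_map val predT g) val_es /E -map_next // !big_map.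
rewrite [LHS]big_seq [RHS]big_seq; apply: eq_bigr => u up /=.
have SE := adj_edge (next_cycle Ep up).
by rewrite /g insubT (@edge_labellingE _ u (next (x :: p) u)).
Qed.

Lemma cycle_steps (C : subgraph G) : is_cycle C -> exists x p,
  [/\ uniq (x :: p), cycle (@adj G) (x :: p), sub_verts C =i x :: p
    & value edge_labelling C = \sum_(s <- steps x (rcons p x)) lab s.1 s.2].
Proof.
case=> -[|x p] [p_gt2 Up Ep verts edges] //.
by exists x, p; split=> //; apply: value_cycle.
Qed.

Lemma steps_cycle x p :
    uniq (x :: p) -> (2 < size (x :: p))%N -> cycle (@adj G) (x :: p) ->
  exists C : subgraph G, [/\ is_cycle C, sub_verts C =i x :: p
    & value edge_labelling C = \sum_(s <- steps x (rcons p x)) lab s.1 s.2].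
Proof.
move=> Up p_gt2 Ep.
pose E := [set e : edge G |
  val e \in [seq [set u; next (x :: p) u]%SET | u <- x :: p]]%SET.
have incE (e : edge G) : e \in E -> val e \subset [set u in x :: p]%SET.
  rewrite finset.in_set => /mapP[u up ->]; apply/fintype.subsetP=> v.
  by rewrite in_set2 finset.in_set => /orP[]/eqP-> //; rewrite mem_next.
exists (Subgraph incE); split=> [|u|] /=; last 1 first.
- by apply: value_cycle => // e; rewrite finset.in_set.
- by exists (x :: p); split=> // u; rewrite finset.in_set.
- by rewrite finset.in_set.
Qed.

End CycleValue.

(** * Parity of crossings in the grid *)

Section GridParity.

Variables W H : nat.
Notation point := ('I_W * 'I_H)%type.
Implicit Types u v w : point.

Definition consecutive (i j : nat) := (i == j.+1) || (j == i.+1).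

Definition grid : rel point := fun u v =>
  (u.1 == v.1 :> nat) && consecutive u.2 v.2
  || (u.2 == v.2 :> nat) && consecutive u.1 v.1.

Definition top_link u v := (u.2 == 0 :> nat) && (v.2 == 0 :> nat).

(** The exclusive or says that exactly one of [u], [u'] has its column in the half-open interval
    between those of [v] and [v']; for four distinct ends on the top row this means that the ends
    interleave. *)
Definition crossing v v' u u' := [&& top_link v v', top_link u u' &
  (u.1 <= v.1) (+) (u'.1 <= v.1) (+) (u.1 <= v'.1) (+) (u'.1 <= v'.1)].

(* Parity of the number of times the step from [u] to [u'] crosses the vertical
   ray going up from the point just right of [v]; a step between two vertices
   of the top row counts as drawn above that row. *)
Definition above v u u' :=
  ((u.2 == 0 :> nat) || (u.2 < v.2)) && ((u.1 <= v.1) (+) (u'.1 <= v.1)).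

(* Moving from [v] to [v'] across a column sweeps the vertices [u] above; a
   step entering or leaving that set changes [above], and such changes cancel
   along a closed walk. *)
Definition corner v v' u := (u.2 < v.2) && ((u.1 <= v.1) (+) (u.1 <= v'.1)).

Lemma point_neq u v : u != v -> ~~ ((u.1 == v.1 :> nat) && (u.2 == v.2 :> nat)).
Proof. by case: u v => [a b] [c d]; rewrite xpair_eqE -!val_eqE. Qed.

Lemma grid_sym : symmetric grid.
Proof. by move=> u v; rewrite /grid /consecutive; lia. Qed.

Lemma grid_irrefl : irreflexive grid.
Proof. by move=> u; rewrite /grid /consecutive; lia. Qed.

Lemma link_cases u v : grid u v || top_link u v ->
  [\/ u.1 = v.1 :> nat /\ (u.2 = v.2.+1 :> nat \/ v.2 = u.2.+1 :> nat),
      u.2 = v.2 :> nat /\ (u.1 = v.1.+1 :> nat \/ v.1 = u.1.+1 :> nat)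
    | u.2 = 0 :> nat /\ v.2 = 0 :> nat].
Proof.
rewrite /grid /consecutive /top_link.
case/orP=> [/orP[]|] /andP[/eqP->].
- by case/orP=> /eqP->; constructor 1; auto.
- by case/orP=> /eqP->; constructor 2; auto.
- by move/eqP->; constructor 3.
Qed.

(** The rays above [v] and [v'] and the step joining them bound a region, whose vertices [corner]
    describes. The step from [u] to [u'] meets this boundary an odd number of times exactly when it
    enters or leaves the region. *)
Lemma above_step v v' u u' :
    grid v v' || top_link v v' -> grid u u' || top_link u u' ->
    v != u -> v != u' -> v' != u -> v' != u' ->
  above v u u' (+) above v' u u' =
  crossing v v' u u' (+) (corner v v' u (+) corner v v' u').
Proof.
move=> /link_cases vv' /link_cases uu'.
move=> /point_neq + /point_neq + /point_neq + /point_neq.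
rewrite /crossing /above /corner /top_link; move: vv' uu'.
move: v v' u u' => [[a ?] [b ?]] [[c ?] [d ?]] [[e ?] [f ?]] [[g ?] [h ?]] /=.
move=> [[-> []->]|[-> []->]|[-> ->]] [[-> []->]|[-> []->]|[-> ->]]; lia.
Qed.

(** A grid edge on the top row has no column strictly between its ends, so the ends of a disjoint
    link cannot interleave with them. *)
Lemma grid_not_crossing v v' u u' : grid v v' || grid u u' ->
  v != u -> v != u' -> v' != u -> v' != u' -> crossing v v' u u' = false.
Proof.
move=> + /point_neq + /point_neq + /point_neq + /point_neq.
rewrite /grid /top_link /crossing /top_link /consecutive.
move: v v' u u' => [[a ?] [b ?]] [[c ?] [d ?]] [[e ?] [f ?]] [[g ?] [h ?]] /=.
lia.
Qed.

Lemma closed_walks_cross_evenly u p v q :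
    path (fun w w' => grid w w' || top_link w w') u p -> last u p = u ->
    path (fun w w' => grid w w' || top_link w w') v q -> last v q = v ->
    {in u :: p, forall w, w \notin v :: q} ->
  \big[addb/false]_(s <- steps v q) \big[addb/false]_(r <- steps u p)
    crossing s.1 s.2 r.1 r.2 = false.
Proof.
move=> up lastp vq lastq disj.
have neq w w' : w \in v :: q -> w' \in u :: p -> w != w'.
  by move=> wq /disj; apply: contraNneq => <-.
transitivity (\big[addb/false]_(s <- steps v q) \big[addb/false]_(r <- steps u p)
    ((above s.1 r.1 r.2 (+) above s.2 r.1 r.2) (+)
     (corner s.1 s.2 r.1 (+) corner s.1 s.2 r.2))).
  rewrite [LHS]big_seq [RHS]big_seq; apply: eq_bigr => s sq.
  have [es s1 s2] := mem_steps vq sq.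
  rewrite [LHS]big_seq [RHS]big_seq; apply: eq_bigr => r rp.
  have [er r1 r2] := mem_steps up rp.
  by rewrite above_step ?neq // addbK.
(* The [corner] terms telescope to nothing along the closed walk [p]; after exchanging the sums, the
   [above] terms do so along [q]. *)
under eq_bigr do rewrite big_split sum_steps_telescope lastp addbb /= addbF.
rewrite exchange_big big1 //= => r _.
by rewrite (sum_steps_telescope (fun w => above w r.1 r.2)) lastq addbb.
Qed.

(** Each path is closed by an arc from its last to its first vertex. Pairs involving a grid edge do
    not cross, so the even total consists of the two closing arcs alone. *)
Lemma grid_paths_not_crossing u p v q :
    path grid u p -> path grid v q ->
    {in u :: p, forall w, w \notin v :: q} ->
  crossing (last v q) v (last u p) u = false.
Proof.
move=> up vq disj.
have neq w w' : w \in v :: q -> w' \in u :: p -> w != w'.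
  by move=> wq /disj; apply: contraNneq => <-.
case: (boolP (top_link (last u p) u && top_link (last v q) v)) => [/andP[tu tv]|];
  last by rewrite /crossing => /negPf; case: top_link => //=; case: top_link.
have closed w r : path grid w r -> top_link (last w r) w ->
    path (fun w w' => grid w w' || top_link w w') w (rcons r w).
  move=> wr tw; rewrite rcons_path tw orbT andbT.
  by apply: sub_path wr => ? ? ->.
have disj' : {in u :: rcons p u, forall w, w \notin v :: rcons q v}.
  move=> w; rewrite !(in_cons, mem_rcons) !orbA !orbb -!in_cons; exact: disj.
have := closed_walks_cross_evenly (closed _ _ up tu) (last_rcons _ _ _)
  (closed _ _ vq tv) (last_rcons _ _ _) disj'.
have grid_big s : s.1 \in v :: q -> s.2 \in v :: q ->
    \big[addb/false]_(r <- steps u p) crossing s.1 s.2 r.1 r.2 = false.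
  move=> s1 s2; rewrite big_seq big1 // => r rp.
  have [er r1 r2] := mem_steps up rp.
  by rewrite grid_not_crossing ?er ?orbT ?neq.
rewrite !steps_rcons big_rcons /= [X in X (+) _]big_seq [X in X (+) _]big1 /=.
  by rewrite big_rcons /= (grid_big (_, _)) ?mem_last ?mem_head.
move=> s sq; have [es s1 s2] := mem_steps vq sq.
rewrite big_rcons grid_big //=.
by rewrite grid_not_crossing ?es ?neq ?mem_last ?mem_head.
Qed.

End GridParity.

(** * Rows and columns that avoid a small set, and paths through them *)

Lemma free_index (T : finType) (f : T -> nat) (X : {set T}) m t : #|X| <= t ->
  exists2 i, m <= i <= m + t & forall x, x \in X -> f x != i.
Proof.
move=> X_t; pose s := [seq f x | x in X].
(* If no index were free, the [t + 1] candidates would be among the at most [t] values of [f] on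
   [X]. *)
have [all_s|] := boolP (all (mem s) (iota m t.+1)).
  have := uniq_leq_size (iota_uniq m t.+1) (allP all_s).
  by rewrite size_iota size_map -cardE; lia.
case/allPn=> i; rewrite mem_iota => im si; exists i; first by lia.
by move=> x xX; apply: contraNneq si => <-; apply: map_f; rewrite mem_enum.
Qed.

Section GridPaths.

Variables W H : nat.
Notation point := ('I_W.+1 * 'I_H.+1)%type.
Implicit Types u v w : point.

Definition pt (i j : nat) : point := (inord i, inord j).

Lemma pt1 i j : i <= W -> (pt i j).1 = i :> nat.
Proof. by move=> ?; rewrite inordK. Qed.

Lemma pt2 i j : j <= H -> (pt i j).2 = j :> nat.
Proof. by move=> ?; rewrite inordK. Qed.

Lemma connect_seq (T : finType) (e : rel T) (f : nat -> T) m n : m <= n ->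
  (forall k, m <= k < n -> e (f k) (f k.+1)) -> connect e (f m) (f n).
Proof.
elim: n => [|n IH] mn ef; first by have -> : m = 0 by lia.
move: mn; rewrite leq_eqVlt => /orP[/eqP-> //|mn].
apply: (@connect_trans _ _ (f n)); last by apply/connect1/ef; lia.
by apply: IH => [|k kn]; [lia | apply: ef; lia].
Qed.

(** Go down column [i] to row [y], along that row, and up column [j], then remove repetitions. *)
Lemma path_below (e : rel point) (S : pred point) i j y :
    symmetric e -> i <= W -> j <= W -> y <= H ->
    (forall x k, x <= W -> k < y -> e (pt x k) (pt x k.+1)) ->
    (forall k, k < W -> e (pt k y) (pt k.+1 y)) ->
    (forall k, k <= y -> S (pt i k) && S (pt j k)) ->
    (forall k, minn i j <= k <= maxn i j -> S (pt k y)) ->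
  exists p, [/\ path e (pt i 0) p, last (pt i 0) p = pt j 0,
                uniq (pt i 0 :: p) & all S (pt i 0 :: p)].
Proof.
move=> eC iW jW yH ecol erow Scol Srow.
(* Building membership in [S] into the relation keeps the shortened path inside [S], whatever its
   shape. *)
pose e' : rel point := fun u v => [&& e u v, S u & S v].
have /sym_connect_sym e'C : symmetric e'.
  by move=> u v; rewrite /e' eC [S u && _]andbC.
have col x : x = i \/ x = j -> connect e' (pt x 0) (pt x y).
  move=> xij; apply: (connect_seq (f := pt x)) => // k ky.
  by rewrite /e' ecol //; have := Scol k; have := Scol k.+1; case: xij => ->; lia.
have row x z : x <= z -> minn i j <= x -> z <= maxn i j ->
    connect e' (pt x y) (pt z y).
  move=> xz ijx zij; apply: (connect_seq (f := pt^~ y)) => // k kxz.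
  by rewrite /e' erow ?Srow //; lia.
have : connect e' (pt i 0) (pt j 0).
  apply: (@connect_trans _ _ (pt i y)); first by apply: col; left.
  apply: (@connect_trans _ _ (pt j y)); last by rewrite e'C col //; right.
  by case: (leqP i j) => ij; [|rewrite e'C]; apply: row; lia.
case/connectP=> q + lastq; rewrite {}lastq => /shortenP[p e'p Up _].
exists p; split=> //; first by apply: sub_path e'p => ? ? /and3P[].
rewrite /= (andP (Scol 0 _)).1 //=; apply/allP=> w wp.
elim: p (pt i 0) e'p wp {Up} => //= v p IH u /andP[/and3P[_ _ Sv] /IH{}IH].
by rewrite inE => /orP[/eqP-> //|/IH].
Qed.

End GridPaths.

(** * Generated subgroups *)

Section Subgroups.

Local Open Scope ring_scope.
Local Open Scope classical_set_scope.

Variable Gamma : zmodType.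
Implicit Types S K : set Gamma.

Lemma sub_gen S : S `<=` gen_subgroup S.
Proof. exact: sub_gen_smallest. Qed.

Lemma gen_min S K : zmod_closed [in K] -> S `<=` K -> gen_subgroup S `<=` K.
Proof. exact: smallest_sub. Qed.

Lemma gen_zmod_closed S : zmod_closed [in gen_subgroup S].
Proof.
split=> [|x y]; rewrite !in_setE.
  by move=> K [[K0 _] _]; rewrite -in_setE.
move=> xS yS K KS; case: (KS) => -[_ KB] _.
by rewrite -in_setE KB ?in_setE; [|apply: xS|apply: yS].
Qed.

Lemma gen0 S : gen_subgroup S 0.
Proof. by have [+ _] := gen_zmod_closed S; rewrite in_setE. Qed.

Lemma genB S x y : gen_subgroup S x -> gen_subgroup S y -> gen_subgroup S (x - y).
Proof. by have [_ B] := gen_zmod_closed S; have := B x y; rewrite !in_setE. Qed.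

Lemma genD S x y : gen_subgroup S x -> gen_subgroup S y -> gen_subgroup S (x + y).
Proof.
by move=> xS yS; rewrite -[y]opprK -[- y]sub0r; do 2!apply: genB => //; apply: gen0.
Qed.

Lemma genMn S x n : gen_subgroup S x -> gen_subgroup S (x *+ n).
Proof.
by move=> xS; elim: n => [|n IH]; rewrite ?mulrS; [apply: gen0 | apply: genD].
Qed.

Lemma genMz S x (n : int) : gen_subgroup S x -> gen_subgroup S (x *~ n).
Proof.
move=> xS; case: n => n; first exact: genMn.
by rewrite NegzE mulrNz -sub0r; apply: genB; [apply: gen0 | apply: genMn].
Qed.

Lemma gen_sum S (I : eqType) (r : seq I) (F : I -> Gamma) :
  {in r, forall i, gen_subgroup S (F i)} -> gen_subgroup S (\sum_(i <- r) F i).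
Proof.
move=> FS; rewrite big_seq; apply: big_ind => //; [exact: gen0 | exact: genD].
Qed.

Lemma gen3P (a b c z : Gamma) : gen_subgroup [set a; b; c] z ->
  exists x y w : int, z = a *~ x + b *~ y + c *~ w.
Proof.
pose K := [set z | exists x y w : int, z = a *~ x + b *~ y + c *~ w].
apply: (@gen_min _ K); last first.
  move=> _ [[->|->]|->]; [exists 1, 0, 0 | exists 0, 1, 0 | exists 0, 0, 1];
    by rewrite !mulr1z !mulr0z ?addr0 ?add0r.
split=> [|u v]; rewrite !in_setE; first by exists 0, 0, 0; rewrite !mulr0z !addr0.
move=> [x [y [w ->]]] [x' [y' [w' ->]]]; exists (x - x'), (y - y'), (w - w').
by rewrite !mulrzBr !opprD addrACA [X in X + _ = _]addrACA.
Qed.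

End Subgroups.

(** * The grid with pairwise crossing chords *)

Section Doubling.

Local Open Scope ring_scope.

Variables (Gamma : zmodType) (A : set Gamma) (t : nat) (a : Gamma).
Hypotheses (Aa : A a) (gen2a : ~ (gen_subgroup [set a *+ 2] `&` A !=set0)%classic)
  (t_gt0 : (0 < t)%N).

Notation V := ('I_(t.+1 + t).+1 * 'I_t.+1)%type.

(** The grid has [2t + 2] columns, so there are [t + 1] chords, whose left ends and right ends come
    in the same order; hence any two interleave. *)
Definition chord : rel V := fun u v =>
  top_link u v && ((v.1 == u.1 + t.+1 :> nat) || (u.1 == v.1 + t.+1 :> nat))%N.

Lemma chord_sym : symmetric chord.
Proof. by move=> u v; rewrite /chord /top_link [X in X && _]andbC orbC. Qed.

Definition chord_adj : rel V := fun u v => grid u v || chord u v.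

Lemma chord_adj_sym : symmetric chord_adj.
Proof. by move=> u v; rewrite /chord_adj grid_sym chord_sym. Qed.

Lemma chord_adj_irrefl : irreflexive chord_adj.
Proof. by move=> u; rewrite /chord_adj grid_irrefl /chord; clear -u; lia. Qed.

Definition chord_graph := SGraph chord_adj_sym chord_adj_irrefl.

Definition chord_label (u v : chord_graph) : Gamma := if chord u v then a else 0.

Lemma chord_labelC u v : chord_label u v = chord_label v u.
Proof. by rewrite /chord_label chord_sym. Qed.

(** Here [t_gt0] enters: for [t = 0] the chord would join adjacent columns. *)
Lemma grid_not_chord u v : grid u v -> chord u v = false.
Proof. by rewrite /grid /chord /consecutive; lia. Qed.

Lemma chords_cross v v' u u' : chord_adj v v' -> chord_adj u u' ->
    v != u -> v != u' -> v' != u -> v' != u' ->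
  crossing v v' u u' = chord v v' && chord u u'.
Proof.
move=> vv' uu' vu vu' v'u v'u'.
case: (boolP (grid v v' || grid u u')) => [g|].
  by rewrite grid_not_crossing //; case/orP: g => /grid_not_chord->; rewrite ?andbF.
case/norP=> /negPf vv'g /negPf uu'g.
move: vv' uu' vu vu' v'u v'u'; rewrite /chord_adj vv'g uu'g /= => cv cu.
rewrite cv cu; move: cv cu => + + /point_neq + /point_neq + /point_neq + /point_neq.
rewrite /chord /crossing /top_link; move: v v' u u' {vv'g uu'g}.
move=> [[x ?] [b ?]] [[c ?] [d ?]] [[e ?] [f ?]] [[g ?] [h ?]] /=.
move=> /andP[/andP[/eqP-> /eqP->] /orP[]/eqP?].
all: by move=> /andP[/andP[/eqP-> /eqP->] /orP[]/eqP?]; lia.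
Qed.

Lemma big_addb_count (T : Type) (P : pred T) (s : seq T) :
  \big[addb/false]_(i <- s) P i = odd (count P s).
Proof. by elim: s => [|i s IH]; rewrite ?big_nil ?big_cons //= oddD IH oddb. Qed.

(** The value is [a] times the number of chord steps; an even number would put it in the subgroup
    generated by [2a], which misses [A]. *)
Lemma value_chord_odd (C : subgraph chord_graph) :
    cycles_with_value_in A (edge_labelling chord_label) C ->
  exists x p, [/\ path chord_adj x p, last x p = x, sub_verts C =i x :: p
    & odd (count (fun s => chord s.1 s.2) (steps x p))].
Proof.
case=> /(cycle_steps chord_labelC)[x [p [_ Ep verts ->]]] AC.
exists x, (rcons p x); rewrite last_rcons; split=> //.
  by move=> u; rewrite verts !(in_cons, mem_rcons) orbA orbb.
move: AC; rewrite -big_mkcond /= big_const_seq iter_addr_0.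
set n := count _ _ => An.
apply: contra_notT gen2a => /even_halfK n2; exists (a *+ 2 *+ n./2).
split; first by apply: genMn; apply: sub_gen.
by rewrite -mulrnA mul2n n2.
Qed.

Lemma chord_graph_no_disjoint : ~ exists C1 C2 : subgraph chord_graph,
  [/\ cycles_with_value_in A (edge_labelling chord_label) C1,
      cycles_with_value_in A (edge_labelling chord_label) C2
    & vertex_disjoint C1 C2].
Proof.
case=> C1 [C2 [/value_chord_odd[u [p [up lastp verts1 odd1]]]
               /value_chord_odd[v [q [vq lastq verts2 odd2]]] disj]].
have {}disj w w' : w \in v :: q -> w' \in u :: p -> w != w'.
  rewrite -verts2 -verts1 => w2 w1; apply: contraTneq w2 => ->.
  by rewrite (disjointFr disj w1).
have links w r : path chord_adj w r ->
    path (fun w w' => grid w w' || top_link w w') w r.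
  by apply: sub_path => ? ? /orP[->//|/andP[-> _]]; rewrite orbT.
have := closed_walks_cross_evenly (links _ _ up) lastp (links _ _ vq) lastq.
case/(_ _)/Bool.not_true_iff_false.
  by move=> w wp; apply/negP=> wq; have := disj w w wq wp; rewrite eqxx.
transitivity (\big[addb/false]_(s <- steps v q) \big[addb/false]_(r <- steps u p)
    (chord s.1 s.2 && chord r.1 r.2)).
  rewrite [LHS]big_seq [RHS]big_seq; apply: eq_bigr => s sq.
  have [es s1 s2] := mem_steps vq sq.
  rewrite [LHS]big_seq [RHS]big_seq; apply: eq_bigr => r rp.
  have [er r1 r2] := mem_steps up rp.
  by rewrite chords_cross ?disj.
(* The double sum factors into the product of the two chord counts, both odd, against the parity
   fact. *)
under eq_bigr do rewrite -big_distrr /= big_addb_count odd1 andbT.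
by rewrite big_addb_count odd2.
Qed.

Lemma chord_graph_no_hitting : ~ exists X : {set chord_graph},
  hitting_set (cycles_with_value_in A (edge_labelling chord_label)) X
    /\ (#|X| <= t)%N.
Proof.
case=> X [hitX X_t].
(* Columns are taken modulo [t + 1], so that one free residue frees both end columns of a chord. *)
have [i it iX] := free_index (fun u : V => u.1 %% t.+1)%N 0 X_t.
have [y yt yX] := free_index (fun u : V => u.2 : nat) 0 X_t.
have freecol (x k : nat) : (x <= t.+1 + t)%N -> (x %% t.+1)%N = i -> pt _ _ x k \notin X.
  by move=> xW xi; apply/negP=> /iX; rewrite pt1 // xi eqxx.
have i_mod : (i %% t.+1)%N = i by rewrite modn_small //; lia.
have iN_mod : ((i + t.+1) %% t.+1)%N = i by rewrite modnDr.
case: (@path_below _ _ (@grid _ _) [pred w | w \notin X] i (i + t.+1)%N y).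
all: try by [exact: grid_sym|lia].
- by move=> x k xW ky; rewrite /grid /consecutive !pt1 ?pt2 //; lia.
- by move=> k kW; rewrite /grid /consecutive !pt1 ?pt2 //; lia.
- by move=> k ky; rewrite !inE !freecol //; lia.
- by move=> k kij; rewrite inE; apply/negP=> /yX; rewrite pt2 ?eqxx //; lia.
move=> p [Ep lastp Up Xp].
set x := pt _ _ i 0 in Ep lastp Up Xp.
have chordx : chord (last x p) x.
  by rewrite lastp /chord /top_link !pt1 ?pt2 //=; lia.
have p_gt2 : (2 < size (x :: p))%N.
  case: p Ep lastp {Up Xp} chordx => [|v [|v' p]] //=.
    by rewrite /chord; lia.
  by rewrite andbT grid_sym => /grid_not_chord->.
have Gp : cycle (@adj chord_graph) (x :: p).
  rewrite /= rcons_path /= /chord_adj chordx orbT andbT.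
  by apply: sub_path Ep => u v uv; rewrite /chord_adj uv.
have [C [cycC verts valC]] := steps_cycle chord_labelC Up p_gt2 Gp.
case: (hitX C).
  (* The closing chord is the only step with a nonzero label, so the value is [a]. *)
  split=> //; rewrite valC steps_rcons big_rcons /= {2}/chord_label chordx.
  rewrite big_seq big1 ?add0r // => s sp; have [es _ _] := mem_steps Ep sp.
  by rewrite /chord_label grid_not_chord.
by move=> w wX; rewrite verts => /(allP Xp); rewrite inE wX.
Qed.

End Doubling.

(** * The grid with labels on three thirds of its top row *)

Section ThreeGenerators.

Local Open Scope ring_scope.

Variables (Gamma : zmodType) (A : set Gamma) (t : nat) (a b c : Gamma).
Hypotheses (Aabc : A (a + b + c))
  (no_ab : forall x, gen_subgroup [set a; b]%classic x -> ~ A x)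
  (no_bc : forall x, gen_subgroup [set b; c]%classic x -> ~ A x)
  (no_ac : forall x, gen_subgroup [set a; c]%classic x -> ~ A x).

Notation W := (6 * t + 5)%N.
Notation V := ('I_W.+1 * 'I_(2 * t + 2).+1)%type.

Definition labelled : rel V := fun u v =>
  top_link u v && ((u.1 : nat)./2 == (v.1 : nat)./2).

Lemma labelled_sym : symmetric labelled.
Proof.
by move=> u v; rewrite /labelled /top_link [X in X && _]andbC [X in _ && X]eq_sym.
Qed.

(* The labelled edges join columns [2i] and [2i+1] in the top row; the three
   ranges of [i] have [t + 1] elements each, so [t] vertices leave an edge of
   each kind whose two columns they avoid. *)
Definition segment (i : nat) : Gamma :=
  if (i <= t)%N then a else if (i <= 2 * t + 1)%N then b else c.

Definition grid_graph := SGraph (@grid_sym W.+1 (2 * t + 2).+1) (@grid_irrefl _ _).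

Definition segment_label (u v : grid_graph) : Gamma :=
  if labelled u v then segment (u.1 : nat)./2 else 0.

Lemma segment_labelC u v : segment_label u v = segment_label v u.
Proof.
by rewrite /segment_label labelled_sym; case: ifP => // /andP[_ /eqP->].
Qed.

Definition unlabelled_grid : rel V := fun u v => grid u v && ~~ labelled u v.

Lemma unlabelled_grid_sym : symmetric unlabelled_grid.
Proof. by move=> u v; rewrite /unlabelled_grid grid_sym labelled_sym. Qed.

Lemma sum_unlabelled (x : grid_graph) p : path unlabelled_grid x p ->
  \sum_(s <- steps x p) segment_label s.1 s.2 = 0.
Proof.
move=> xp; rewrite big_seq big1 // => s /(mem_steps xp)[/andP[_ /negPf sN] _ _].
by rewrite /segment_label sN.
Qed.

(** A cycle missing the range [I] of the top row only meets labels [g], [g'] and 0, so its value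
    would lie in a subgroup that misses [A]. *)
Lemma value_needs_segment (C : subgraph grid_graph) (g g' : Gamma) (I : pred nat) :
    cycles_with_value_in A (edge_labelling segment_label) C ->
    (forall x, gen_subgroup [set g; g']%classic x -> ~ A x) ->
    (forall i, ~~ I i -> segment i = g \/ segment i = g') ->
  exists2 w, w \in sub_verts C & (w.2 == 0 :> nat) && I (w.1 : nat)./2.
Proof.
case=> /(cycle_steps segment_labelC)[x [p [_ Ep verts ->]]] AC noA Igg'.
have [/hasP[w wp Iw]|noI] :=
    boolP (has (fun w : V => (w.2 == 0 :> nat) && I (w.1 : nat)./2) (x :: p)).
  by exists w; rewrite ?verts.
case: (noA _ _ AC); apply: gen_sum => s.
case/(mem_steps (Ep : path (@adj grid_graph) x _)) => _ s1 _; rewrite /segment_label.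
case: ifP => [/andP[/andP[s10 _] _]|_]; last exact: gen0.
have s1x : s.1 \in x :: p by move: s1; rewrite !(in_cons, mem_rcons) orbA orbb.
have := hasPn noI _ s1x; rewrite s10 /= => /Igg'[->|->]; apply: sub_gen.
  by left.
by right.
Qed.

Lemma value_touches (C : subgraph grid_graph) :
    cycles_with_value_in A (edge_labelling segment_label) C ->
  exists wa wb wc : V,
    [/\ wa \in sub_verts C, wb \in sub_verts C & wc \in sub_verts C] /\
    [/\ [/\ wa.2 = 0 :> nat, wb.2 = 0 :> nat & wc.2 = 0 :> nat]%N,
        ((wa.1 : nat)./2 <= t)%N,
        (t < (wb.1 : nat)./2 <= 2 * t + 1)%N & (2 * t + 1 < (wc.1 : nat)./2)%N].
Proof.
move=> OC.
have [|wa Ca /andP[/eqP a0 aI]] :=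
    value_needs_segment (I := fun i => i <= t)%N OC no_bc.
  by move=> i /negPf it; rewrite /segment it; case: ifP; [left | right].
have [|wb Cb /andP[/eqP b0 bI]] :=
    value_needs_segment (I := fun i => t < i <= 2 * t + 1)%N OC no_ac.
  move=> i ti; rewrite /segment; case: (leqP i t) => [|it]; first by left.
  by case: leqP => [|_]; [lia | right].
have [|wc Cc /andP[/eqP c0 cI]] :=
    value_needs_segment (I := fun i => 2 * t + 1 < i)%N OC no_ab.
  by move=> i; rewrite -leqNgt /segment => ->; case: ifP; [left | right].
by exists wa, wb, wc.
Qed.

Lemma ordered_touches (C1 C2 : subgraph grid_graph) (b1 c1 a2 b2 : V) :
    is_cycle C1 -> is_cycle C2 -> vertex_disjoint C1 C2 ->
    b1 \in sub_verts C1 -> c1 \in sub_verts C1 ->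
    a2 \in sub_verts C2 -> b2 \in sub_verts C2 ->
    [&& b1.2 == 0 :> nat, c1.2 == 0 :> nat, a2.2 == 0 :> nat & b2.2 == 0 :> nat]%N ->
  ~ [/\ (a2.1 < b1.1)%N, (b1.1 <= b2.1)%N & (b2.1 < c1.1)%N].
Proof.
case=> p1 [_ U1 E1 verts1 _] [p2 [_ U2 E2 verts2 _]] disj.
rewrite !verts1 !verts2 => b1p c1p a2p b2p.
case/and4P=> b10 c10 a20 b20 [ab bb bc].
have [q1 [Eq1 last1 sub1]] := cycle_subpath U1 E1 b1p c1p.
have [q2 [Eq2 last2 sub2]] := cycle_subpath U2 E2 a2p b2p.
(* The columns come in the order [a2], [b1], [b2], [c1]; of the four comparisons in [crossing] only
   that of [b1] with [b2] holds, so the exclusive or is true. *)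
suff /negP: crossing (last a2 q2) a2 (last b1 q1) b1 = false.
  apply; rewrite last1 last2 /crossing /top_link b10 c10 a20 b20 bb /=.
  have ac : (a2.1 < c1.1)%N := ltn_trans (leq_trans ab bb) bc.
  by rewrite !(leqNgt c1.1) bc ac (leqNgt b1.1 a2.1) ab.
apply: grid_paths_not_crossing => // w /sub1; rewrite -verts1 => w1.
by apply/negP=> /sub2; rewrite -verts2 (disjointFr disj w1).
Qed.

Lemma grid_graph_no_disjoint : ~ exists C1 C2 : subgraph grid_graph,
  [/\ cycles_with_value_in A (edge_labelling segment_label) C1,
      cycles_with_value_in A (edge_labelling segment_label) C2
    & vertex_disjoint C1 C2].
Proof.
case=> C1 [C2 [OC1 OC2 disj]].
have [a1 [b1 [c1 [[Ca1 Cb1 Cc1] [[a10 b10 c10] a1I b1I c1I]]]]] := value_touches OC1.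
have [a2 [b2 [c2 [[Ca2 Cb2 Cc2] [[a20 b20 c20] a2I b2I c2I]]]]] := value_touches OC2.
have half_lt (m n : nat) : (m./2 < n./2)%N -> (m < n)%N.
  by rewrite !ltnNge; apply/contra/half_leq.
(* The two cases differ by exchanging the cycles: the one touching the middle third further left
   supplies the path to the right third. *)
case: (leqP b1.1 b2.1) => b12.
  case: (ordered_touches OC1.1 OC2.1 disj Cb1 Cc1 Ca2 Cb2).
    by rewrite b10 c10 a20 b20.
  split; [apply: half_lt | exact: b12 | apply: half_lt].
    exact: leq_ltn_trans a2I (andP b1I).1.
  exact: leq_ltn_trans (andP b2I).2 c1I.
have disj' : vertex_disjoint C2 C1 by rewrite /vertex_disjoint disjoint_sym.
case: (ordered_touches OC2.1 OC1.1 disj' Cb2 Cc2 Ca1 Cb1).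
  by rewrite b20 c20 a10 b10.
split; [apply: half_lt | exact: ltnW | apply: half_lt].
  exact: leq_ltn_trans a1I (andP b2I).1.
exact: leq_ltn_trans (andP b1I).2 c2I.
Qed.

(** Since [0 < y], the horizontal part stays off the top row and no labelled edge is used. The
    region [P] serves to keep several such paths disjoint. *)
Lemma unlabelled_path (X : {set V}) (P : nat -> nat -> bool) i j y :
    (i <= W)%N -> (j <= W)%N -> (0 < y <= 2 * t + 2)%N ->
    {in X, forall w : V, [/\ (w.1 : nat)./2 != i./2, (w.1 : nat)./2 != j./2 &
      w.2 != y :> nat]} ->
    (forall k, (k <= y)%N -> P i k && P j k) ->
    (forall k, (minn i j <= k <= maxn i j)%N -> P k y) ->
  exists p, [/\ path unlabelled_grid (pt _ _ i 0) p,
    last (pt _ _ i 0) p = pt _ _ j 0, uniq (pt _ _ i 0 :: p)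
    & all (fun w : V => (w \notin X) && P w.1 w.2) (pt _ _ i 0 :: p)].
Proof.
move=> iW jW /andP[y0 yH] freeX Pcol Prow.
apply: (path_below (y := y)) => //; first exact: unlabelled_grid_sym.
- move=> x k xW ky; rewrite /unlabelled_grid /labelled /top_link /grid /consecutive.
  by rewrite !pt1 ?pt2 //; lia.
- move=> k kW; rewrite /unlabelled_grid /labelled /top_link /grid /consecutive.
  by rewrite !pt1 ?pt2 //; lia.
- move=> k ky; have /andP[Pi Pj] := Pcol k ky; have kH := leq_trans ky yH.
  rewrite !pt1 ?pt2 // Pi Pj !andbT.
  by apply/andP; split; apply/negP=> /freeX[]; rewrite pt1 // eqxx.
- move=> k kij; have kW : (k <= W)%N by lia.
  rewrite pt1 ?pt2 // Prow // andbT.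
  by apply/negP=> /freeX[_ _]; rewrite pt2 // eqxx.
Qed.

Lemma segment_edge n : (2 * n < W)%N ->
  grid (pt W (2 * t + 2) (2 * n) 0) (pt _ _ (2 * n + 1) 0) /\
  segment_label (pt _ _ (2 * n) 0) (pt _ _ (2 * n + 1) 0) = segment n.
Proof.
move=> nW; have half1 : ((2 * n + 1)./2 = n)%N by lia.
have half2 : ((2 * n)./2 = n)%N by lia.
rewrite /segment_label /labelled /top_link /grid /consecutive.
by rewrite !pt1 ?pt2 ?half1 ?half2 ?eqxx //=; [split=> //|..]; lia.
Qed.

Lemma grid_graph_no_hitting : ~ exists X : {set grid_graph},
  hitting_set (cycles_with_value_in A (edge_labelling segment_label)) X
    /\ (#|X| <= t)%N.
Proof.
case=> X [hitX X_t].
(* Halved columns free both ends of one labelled edge in each third. Row [y] carries the paths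
   between consecutive thirds, and the deeper row [z] the way back. *)
have [i iI iX] := free_index (fun u : V => (u.1 : nat)./2) 0 X_t.
have [j jI jX] := free_index (fun u : V => (u.1 : nat)./2) (t + 1) X_t.
have [k kI kX] := free_index (fun u : V => (u.1 : nat)./2) (2 * t + 2) X_t.
have [y yI yX] := free_index (fun u : V => u.2 : nat) 1 X_t.
have [z zI zX] := free_index (fun u : V => u.2 : nat) (t + 2) X_t.
have [iW jW kW] : [/\ 2 * i < W, 2 * j < W & 2 * k < W]%N by split; lia.
have [si sj sk] : [/\ segment i = a, segment j = b & segment k = c].
  rewrite /segment; split; first by have -> : (i <= t)%N by lia.
    have -> : (j <= t)%N = false by lia.
    by have -> : (j <= 2 * t + 1)%N by lia.
  have -> : (k <= t)%N = false by lia.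
  by have -> : (k <= 2 * t + 1)%N = false by lia.
have half1 n : ((2 * n + 1)./2 = n)%N by lia.
have half2 n : ((2 * n)./2 = n)%N by lia.
(* The three regions are pairwise disjoint: two boxes reaching down to row [y], and everything
   beside or below them. This separates the paths although their shapes after shortening are
   unknown. *)
pose P1 m n := [&& 2 * i < m, m <= 2 * j & n <= y]%N.
pose P2 m n := [&& 2 * j < m, m <= 2 * k & n <= y]%N.
pose P3 m n := [|| m <= 2 * i, 2 * k < m | y < n]%N.
have P12 m n : ~~ (P1 m n && P2 m n) by rewrite /P1 /P2; lia.
have P13 m n : ~~ (P1 m n && P3 m n) by rewrite /P1 /P3; lia.
have P23 m n : ~~ (P2 m n && P3 m n) by rewrite /P2 /P3; lia.
have [||||||p1 [Ep1 last1 U1 Xp1]] :=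
  @unlabelled_path X P1 (2 * i + 1) (2 * j) y; rewrite /P1; try lia.
  by move=> w wX; rewrite half1 half2 iX ?jX ?yX.
have [||||||p2 [Ep2 last2 U2 Xp2]] :=
  @unlabelled_path X P2 (2 * j + 1) (2 * k) y; rewrite /P2; try lia.
  by move=> w wX; rewrite half1 half2 jX ?kX ?yX.
have [||||||p3 [Ep3 last3 U3 Xp3]] :=
  @unlabelled_path X P3 (2 * k + 1) (2 * i) z; rewrite /P3.
- by clear -kI; lia.
- by clear -iI; lia.
- by clear -zI; lia.
- by move=> w wX; rewrite half1 half2 kX ?iX ?zX.
- by move=> n _; clear -i k; lia.
- by move=> n _; clear -yI zI; lia.
set x1 := pt _ _ (2 * i + 1) 0 in Ep1 last1 U1 Xp1.
set x2 := pt _ _ (2 * j + 1) 0 in Ep2 last2 U2 Xp2.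
set x3 := pt _ _ (2 * k + 1) 0 in Ep3 last3 U3 Xp3.
have [E12 lab12] := segment_edge jW.
have [E23 lab23] := segment_edge kW.
have [E31 lab31] := segment_edge iW.
have gridp x p : path unlabelled_grid x p -> path (@grid _ _) x p.
  by apply: sub_path => u v /andP[].
pose p := p1 ++ (x2 :: p2) ++ (x3 :: p3).
have lastp : last x1 p = pt _ _ (2 * i) 0 by rewrite /p !last_cat /= last3.
have Ep : cycle (@adj grid_graph) (x1 :: p).
  rewrite /= rcons_path lastp E31 andbT /p.
  rewrite cat_path gridp //= last1 E12 cat_path gridp //= last2 E23.
  exact: gridp.
have disjoint_regions (P P' : nat -> nat -> bool) q q' :
    all (fun w : V => (w \notin X) && P w.1 w.2) q ->
    all (fun w : V => (w \notin X) && P' w.1 w.2) q' ->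
    (forall m n, ~~ (P m n && P' m n)) -> ~~ has (mem q) q'.
  move=> Pq Pq' PP'; apply/hasPn=> w /(allP Pq')/andP[_ P'w].
  by apply/negP=> /(allP Pq)/andP[_ Pw]; have := PP' w.1 w.2; rewrite Pw P'w.
have Up : uniq (x1 :: p).
  rewrite /p -cat_cons !cat_uniq U1 U2 U3 has_cat negb_or.
  have D12 := disjoint_regions _ _ _ _ Xp1 Xp2 P12.
  have D13 := disjoint_regions _ _ _ _ Xp1 Xp3 P13.
  have D23 := disjoint_regions _ _ _ _ Xp2 Xp3 P23.
  by rewrite D12 D13 D23.
have p_gt2 : (2 < size (x1 :: p))%N.
  rewrite [size _]/= /p !size_cat ltnS; apply: leq_trans (leq_addl _ _).
  exact: (@leq_add 1 1).
have [C [cycC verts valC]] := steps_cycle segment_labelC Up p_gt2 Ep.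
case: (hitX C).
  (* The paths contribute 0; the closing edge contributes [a], and the edges into [x2] and [x3]
     contribute [b] and [c]. *)
  split=> //; rewrite valC steps_rcons big_rcons /= lastp lab31 /p steps_cat.
  rewrite big_cat sum_unlabelled //= last1 add0r.
  rewrite -[steps _ _]/((_, x2) :: steps x2 (p2 ++ x3 :: p3)) big_cons lab12.
  rewrite steps_cat big_cat sum_unlabelled //= last2 add0r.
  rewrite -[steps _ (x3 :: p3)]/((_, x3) :: steps x3 p3) big_cons lab23.
  rewrite sum_unlabelled // addr0 si sj sk.
  by rewrite addrC addrA.
have allX : all [predC X] (x1 :: p).
  rewrite /p -cat_cons !all_cat.
  by apply/and3P; split; [move: Xp1|move: Xp2|move: Xp3]; apply: sub_all => w /andP[].
by move=> w wX; rewrite verts => /(allP allX); rewrite /= wX.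
Qed.

End ThreeGenerators.

(** * The two cases of the theorem *)

Theorem theorem1p2 (Gamma : zmodType) (A : set Gamma)
    (hA : ~ doubling_condition A \/ ~ three_generator_condition A)
    (t : nat) (ht : 0 < t) :
  exists (G : sgraph) (gamma : labelling Gamma G),
    (~ exists C1 C2 : subgraph G,
         [/\ cycles_with_value_in A gamma C1,
             cycles_with_value_in A gamma C2
           & vertex_disjoint C1 C2]) /\
    (~ exists X : {set G},
         hitting_set (cycles_with_value_in A gamma) X /\ #|X| <= t).
Proof.
case: hA => [/existsNP[a /not_implyP[Aa gen2a]]|].
  exists (chord_graph t), (edge_labelling (chord_label a)); split.
    exact: chord_graph_no_disjoint.
  exact: chord_graph_no_hitting.
case/existsNP=> a /existsNP[b /existsNP[c /not_implyP[[z [abcz Az]] no2]]].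
have [x [y [w zE]]] := gen3P abcz.
have [gab gbc gac] : [/\ forall z, gen_subgroup [set a; b]%classic z -> ~ A z,
    forall z, gen_subgroup [set b; c]%classic z -> ~ A z &
    forall z, gen_subgroup [set a; c]%classic z -> ~ A z].
  by split=> z' gz' Az'; apply: no2; exists z'; split=> //;
    [left; left | left; right | right].
(* The coefficients of [z] make [a' + b' + c'] equal to [z], while pairs of multiples generate
   smaller subgroups, which still miss [A]. *)
pose a' := (a *~ x)%R; pose b' := (b *~ y)%R; pose c' := (c *~ w)%R.
have multiples g g' m n : (gen_subgroup [set (g *~ m)%R; (g' *~ n)%R]
    `<=` gen_subgroup [set g; g'])%classic.
  apply: gen_min; first exact: gen_zmod_closed.
  by move=> _ [->|->]; apply: genMz; apply: sub_gen; [left|right].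
exists (grid_graph t), (edge_labelling (segment_label a' b' c')); split.
  by apply: grid_graph_no_disjoint => z' /multiples; [apply: gab|apply: gbc|apply: gac].
by apply: grid_graph_no_hitting; rewrite -zE.
Qed.
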